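(* Let $F\subset\mathbb{R}^2$ be an unbounded convex quadrilateral with no sides parallel. Then there exist $S\subset T\subset\mathbb{R}^2$, with $|S|=2$ and $|T|=4$, such that $V_T(S)=F$.
   Context: For a finite nonempty set $T\subset\mathbb{R}^n$ and a nonempty proper subset $S\subset T$, the multipoint (higher order) Voronoi cell is $$V_T(S):=\left\{x\in\mathbb{R}^n : \max_{s\in S}\|x-s\|\le\min_{t\in T\setminus S}\|x-t\|\right\},$$ where $\|\cdot\|$ is the Euclidean norm. An unbounded convex polygon is an unbounded intersection of finitely many closed halfplanes in $\mathbb{R}^2$ with nonempty interior; its sides are its one-dimensional faces and its vertices are its extreme points. An unbounded convex quadrilateral is an unbounded convex polygon with exactly four sides and three vertices (two bounded sides, which are segments, and two unbounded sides, which are rays). *)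

(* Defs.v *)
From HB Require Import structures.
From mathcomp Require Import all_boot all_order all_algebra finmap.
From mathcomp Require Import all_classical all_reals all_analysis.

Set Implicit Arguments.
Unset Strict Implicit.
Unset Printing Implicit Defensive.

Import Order.TTheory GRing.Theory Num.Theory.
Import numFieldNormedType.Exports.

Local Open Scope classical_set_scope.
Local Open Scope card_scope.
Local Open Scope ring_scope.

Definition dotv (R : realType) (n : nat) (u v : 'rV[R]_n) : R :=
  \sum_(i < n) u 0 i * v 0 i.

(* The library's norm on 'rV[R]_n is the sup norm, hence this definition. *)
Definition enorm (R : realType) (n : nat) (u : 'rV[R]_n) : R :=
  Num.sqrt (dotv u u).

(* The max and min are taken in \bar R so as to have neutral elements; for
   S nonempty and proper in T they are the usual ones. *)
Definition voronoi_cell (R : realType) (n : nat) (T S : {fset 'rV[R]_n}) :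
    set 'rV[R]_n :=
  [set x | (\big[maxe/-oo]_(s <- S) (enorm (x - s))%:E <=
            \big[mine/+oo]_(t <- (T `\` S)%fset) (enorm (x - t))%:E)%E].

Definition line (R : realType) (n : nat) (p u : 'rV[R]_n) : set 'rV[R]_n :=
  [set p + t *: u | t in [set: R]].

Definition ray (R : realType) (n : nat) (p u : 'rV[R]_n) : set 'rV[R]_n :=
  [set p + t *: u | t in `[0, +oo[].

Definition closed_segment (R : realType) (n : nat) (x y : 'rV[R]_n) :
    set 'rV[R]_n :=
  [set (1 - t) *: x + t *: y | t in `[0, 1]].

Definition open_segment (R : realType) (n : nat) (x y : 'rV[R]_n) :
    set 'rV[R]_n :=
  [set (1 - t) *: x + t *: y | t in `]0, 1[].

Definition is_ray (R : realType) (n : nat) (A : set 'rV[R]_n) : Prop :=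
  exists p u : 'rV[R]_n, u != 0 /\ A = ray p u.

Definition is_segment (R : realType) (n : nat) (A : set 'rV[R]_n) : Prop :=
  exists x y : 'rV[R]_n, x != y /\ A = closed_segment x y.

Definition affine_set (R : realType) (n : nat) (A : set 'rV[R]_n) : Prop :=
  forall (x y : 'rV[R]_n) (t : R), A x -> A y -> A ((1 - t) *: x + t *: y).

Definition affine_hull (R : realType) (n : nat) (A : set 'rV[R]_n) :
    set 'rV[R]_n :=
  smallest (@affine_set R n) A.

Definition one_dimensional (R : realType) (n : nat) (A : set 'rV[R]_n) : Prop :=
  exists p u : 'rV[R]_n, u != 0 /\ affine_hull A = line p u.

Definition parallel (R : realType) (n : nat) (A B : set 'rV[R]_n) : Prop :=
  exists p q u : 'rV[R]_n,
    [/\ u != 0, affine_hull A = line p u & affine_hull B = line q u].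

Definition face (R : realType) (n : nat) (F G : set 'rV[R]_n) : Prop :=
  [/\ G `<=` F,
      convex_set (G : set (convex_lmodType 'rV[R]_n)) &
      forall x y z : 'rV[R]_n, F x -> F y -> G z -> open_segment x y z ->
        G x /\ G y].

Definition sides (R : realType) (F : set 'rV[R]_2) : set (set 'rV[R]_2) :=
  [set G | face F G /\ one_dimensional G].

Definition vertices (R : realType) (F : set 'rV[R]_2) : set 'rV[R]_2 :=
  [set x | F x /\ forall y z : 'rV[R]_2, F y -> F z -> open_segment y z x ->
             y = x /\ z = x].

Definition closed_halfplane (R : realType) (H : set 'rV[R]_2) : Prop :=
  exists (a : 'rV[R]_2) (b : R), a != 0 /\ H = [set x | dotv a x <= b].

Definition unbounded_convex_polygon (R : realType) (F : set 'rV[R]_2) : Prop :=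
  [/\ exists (m : nat) (H : 'I_m -> set 'rV[R]_2),
        (forall i, closed_halfplane (H i)) /\ F = \bigcap_i H i,
      ~ bounded_set F &
      F° !=set0].

Definition unbounded_convex_quadrilateral (R : realType) (F : set 'rV[R]_2) :
    Prop :=
  [/\ unbounded_convex_polygon F,
      sides F #= `I_4,
      vertices F #= `I_3,
      [set G | sides F G /\ bounded_set G /\ is_segment G] #= `I_2 &
      [set G | sides F G /\ ~ bounded_set G /\ is_ray G] #= `I_2].

Definition no_sides_parallel (R : realType) (F : set 'rV[R]_2) : Prop :=
  forall G1 G2 : set 'rV[R]_2,
    sides F G1 -> sides F G2 -> G1 <> G2 -> ~ parallel G1 G2.

(* Main.v *)
(* F is cut out by four irredundant constraints a_i.x <= b_i whose edges are
   exactly the sides of F.  An unbounded side gives, after a perturbation, a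
   direction d with a_i.d < 0 for all i, so the normals can be ordered by slope.
   Irredundancy makes the vectors (a_i, b_i) of R^3 satisfy a linear relation
   l1 v1 + l3 v3 = l2 v2 + l4 v4 with all l_i > 0.  The bisectors of a
   four-point configuration satisfy the relation
   (t1 - s1) + (t2 - s2) = (t1 - s2) + (t2 - s1) and its analogue for the
   offsets, so after rescaling the constraints by the l_i it remains to find
   one point p and a common scale nu > 0: a square linear system, whose
   determinant is nonzero because the composition of the reflections in the
   four sides is a nontrivial rotation; p is the fixed point of that rotation.
*)
Require Import Defs.
From mathcomp Require Import all_boot all_order all_algebra finmap.
From mathcomp Require Import all_classical all_reals all_analysis.
From mathcomp Require Import ring lra.

Set Implicit Arguments.
Unset Strict Implicit.
Unset Printing Implicit Defensive.

Import Order.TTheory GRing.Theory Num.Theory.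
Import numFieldNormedType.Exports.

Local Open Scope classical_set_scope.
Local Open Scope card_scope.
Local Open Scope ring_scope.

(** * Dot products, bisectors and Voronoi cells of pairs *)

Section DotProduct.
Variables (R : realType) (n : nat).
Implicit Types (u v w : 'rV[R]_n) (k : R).

Lemma dotvC u v : dotv u v = dotv v u.
Proof. by apply: eq_bigr => i _; rewrite mulrC. Qed.

Lemma dotvDr u v w : dotv u (v + w) = dotv u v + dotv u w.
Proof. by rewrite -big_split; apply: eq_bigr => i _; rewrite mxE mulrDr. Qed.

Lemma dotvZr k u v : dotv u (k *: v) = k * dotv u v.
Proof. by rewrite /dotv big_distrr; apply: eq_bigr => i _; rewrite mxE mulrCA. Qed.

Lemma dotvNr u v : dotv u (- v) = - dotv u v.
Proof. by rewrite -scaleN1r dotvZr mulN1r. Qed.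

Lemma dotvDl u v w : dotv (u + v) w = dotv u w + dotv v w.
Proof. by rewrite !(dotvC _ w) dotvDr. Qed.

Lemma dotvZl k u v : dotv (k *: u) v = k * dotv u v.
Proof. by rewrite !(dotvC _ v) dotvZr. Qed.

Lemma dotvNl u v : dotv (- u) v = - dotv u v.
Proof. by rewrite !(dotvC _ v) dotvNr. Qed.

Lemma dotv_ge0 u : 0 <= dotv u u.
Proof. by apply: sumr_ge0 => i _; rewrite -expr2 sqr_ge0. Qed.

Lemma dotv_gt0 u : u != 0 -> 0 < dotv u u.
Proof.
apply: contraNT; rewrite -leNgt => u_le0; apply/eqP/rowP => i.
have /eqP := le_anti (introT andP (conj u_le0 (dotv_ge0 u))).
rewrite psumr_eq0 => [/allP/(_ i (mem_index_enum _))|j _]; last first.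
  by rewrite -expr2 sqr_ge0.
by rewrite mulf_eq0 orbb mxE => /eqP.
Qed.

(** The squared distances from [x] to the two points differ by [2 * nu * (c - dotv w x)]. *)
Lemma enorm_bisector (x s w : 'rV[R]_n) (nu c : R) : 0 < nu ->
  2 * dotv s w + nu * dotv w w = 2 * c ->
  (enorm (x - s) <= enorm (x - (s + nu *: w))) = (dotv w x <= c).
Proof.
move=> nu_gt0 eqc; rewrite ler_sqrt ?dotv_ge0// -subr_ge0 -[RHS]subr_ge0.
rewrite -[RHS](@pmulr_rge0 _ (2 * nu)) ?mulr_gt0//; congr (0 <= _).
rewrite mulrBr -mulrA mulrCA -eqc.
rewrite !(dotvDl, dotvDr, dotvNl, dotvNr, dotvZl, dotvZr).
rewrite (dotvC x s) (dotvC s w) (dotvC x w); ring.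
Qed.

End DotProduct.

Lemma voronoi_cell_pairs (R : realType) (n : nat) (s1 s2 t1 t2 : 'rV[R]_n) :
  uniq [:: s1; s2; t1; t2] ->
  voronoi_cell [fset s1; s2; t1; t2]%fset [fset s1; s2]%fset =
  [set x | [/\ enorm (x - s1) <= enorm (x - t1),
               enorm (x - s1) <= enorm (x - t2),
               enorm (x - s2) <= enorm (x - t1) &
               enorm (x - s2) <= enorm (x - t2)]].
Proof.
rewrite /= !inE !negb_or => /and4P[/and3P[s12 s1t1 s1t2] /andP[s2t1 s2t2] t12 _].
rewrite /voronoi_cell; have -> : ([fset s1; s2; t1; t2] `\` [fset s1; s2] = [fset t1; t2])%fset.
  apply/fsetP => z; rewrite !inE.
  case: (eqVneq z s1) => [->|_]; first by rewrite (negPf s1t1) (negPf s1t2).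
  case: (eqVneq z s2) => [->|_]; first by rewrite (negPf s2t1) (negPf s2t2).
  by [].
apply/seteqP; split => x /=.
- rewrite !big_fsetU1 ?inE ?s12 ?t12//= !big_seq_fset1.
  by rewrite ge_max !le_min !lee_fin => /andP[/andP[-> ->] /andP[-> ->]].
- rewrite !big_fsetU1 ?inE ?s12 ?t12//= !big_seq_fset1.
  by rewrite ge_max !le_min !lee_fin => -[-> -> -> ->].
Qed.

(** * Four points with prescribed bisectors *)

Section Plane.
Variable R : realType.
Implicit Types (u v w x a : 'rV[R]_2).

Definition cross u v : R := u 0 0 * v 0 1 - u 0 1 * v 0 0.

Definition perp u : 'rV[R]_2 := \row_i (if i == 0 then - u 0 1 else u 0 0).

Lemma dotv2 u v : dotv u v = u 0 0 * v 0 0 + u 0 1 * v 0 1.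
Proof.
rewrite /dotv big_ord_recl big_ord1.
by have -> : lift ord0 ord0 = 1 :> 'I_2 by apply/val_inj.
Qed.

Lemma row2P u v : u 0 0 = v 0 0 -> u 0 1 = v 0 1 -> u = v.
Proof.
move=> uv0 uv1; apply/rowP => i; case: (eqVneq i 0) => [->//|i_neq0].
suff -> : i = 1 by [].
by apply/val_inj; case: i i_neq0 => -[|[|]].
Qed.


(** With [s1 = p - nu *: n1], [s2 = p - nu *: n2] and [t = s1 + nu *: n4 = s2 + nu *: n3], the
    equations are the bisector conditions for the pairs [s1 p], [s2 p], [s2 t], [s1 t]. The third
    follows from the other three by the two relations. *)
Lemma reflections_solvable n1 n2 n3 n4 (c1 c2 c3 c4 : R) :
    n1 + n3 = n2 + n4 -> c1 + c3 = c2 + c4 -> cross n1 n2 != 0 ->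
    0 < cross n1 n2 * dotv n3 n4 + dotv n1 n2 * cross n3 n4 ->
    0 < cross n2 n4 * c1 - cross n1 n4 * c2 + cross n1 n2 * c4 ->
  exists (p : 'rV[R]_2) (nu : R), [/\ 0 < nu,
    2 * dotv p n1 - nu * dotv n1 n1 = 2 * c1,
    2 * dotv p n2 - nu * dotv n2 n2 = 2 * c2,
    2 * dotv p n3 - 2 * nu * dotv n2 n3 + nu * dotv n3 n3 = 2 * c3 &
    2 * dotv p n4 - 2 * nu * dotv n1 n4 + nu * dotv n4 n4 = 2 * c4].
Proof.
move=> eqn eqc n12_neq0 E_gt0 D_gt0.
set E := (X in 0 < X) in E_gt0; set D := (X in 0 < X) in D_gt0.
(* This value is forced: eliminating [p] from the first, second and fourth equations leaves
   [nu * E = 2 * D]. *)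
pose nu := 2 * D / E.
have nuE : nu * E = 2 * D by rewrite divfK ?gt_eqF.
pose e1 := c1 + nu / 2 * dotv n1 n1; pose e2 := c2 + nu / 2 * dotv n2 n2.
(* Cramer's rule for the first two equations, with [nu] as a parameter. *)
pose p : 'rV[R]_2 := \row_i (if i == 0
  then (e1 * n2 0 1 - e2 * n1 0 1) / cross n1 n2
  else (e2 * n1 0 0 - e1 * n2 0 0) / cross n1 n2).
have p1 : dotv p n1 = e1.
  by rewrite dotv2 !mxE /=; move: n12_neq0; rewrite /cross => ?; field.
have p2 : dotv p n2 = e2.
  by rewrite dotv2 !mxE /=; move: n12_neq0; rewrite /cross => ?; field.
have n3E : n3 = n2 + n4 - n1 by rewrite -eqn addrAC subrr add0r.
have c3E : c3 = c2 + c4 - c1 by lra.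
have p4 : 2 * dotv p n4 - 2 * nu * dotv n1 n4 + nu * dotv n4 n4 = 2 * c4.
  have p4' : cross n1 n2 * dotv p n4 = cross n1 n4 * e2 - cross n2 n4 * e1.
    by rewrite -p1 -p2 !dotv2 /cross; ring.
  apply: (mulfI n12_neq0); apply/eqP; rewrite -subr_eq0; apply/eqP.
  transitivity (nu * E - 2 * D); last by rewrite nuE subrr.
  have -> : 2 * dotv p n4 = 2 * (cross n1 n4 * e2 - cross n2 n4 * e1) / cross n1 n2.
    by rewrite -p4' mulrA mulrAC mulfK // mulrC.
  rewrite /E /D n3E /e1 /e2; move: n12_neq0; rewrite /cross !dotv2 !mxE => n12; field.
  exact: n12.
exists p, nu; split => //.
- by rewrite divr_gt0 ?mulr_gt0.
- by rewrite p1 /e1; field.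
- by rewrite p2 /e2; field.
- rewrite n3E c3E; move: p1 p2 p4; rewrite /e1 /e2 !dotv2 !mxE; lra.
Qed.

(* Up to a positive factor the left-hand side is the sine of the sum of the
   angles from a1 to a2 and from a3 to a4, a sum lying in (0, pi). *)
Lemma sine_gt0 a1 a2 a3 a4 :
    0 < cross a1 a2 -> 0 < cross a1 a3 -> 0 < cross a1 a4 ->
    0 < cross a2 a3 -> 0 < cross a3 a4 ->
  0 < cross a1 a2 * dotv a3 a4 + dotv a1 a2 * cross a3 a4.
Proof.
move=> p12 p13 p14 p23 p34.
(* Multiplied by this factor, the expression becomes a squared norm plus a positive multiple of
   [dotv a3 a3]. *)
have k_gt0 : 0 < cross a2 a3 * (cross a1 a3 * cross a3 a4) by rewrite !mulr_gt0.
rewrite -(pmulr_rgt0 _ k_gt0).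
pose v := (cross a1 a3 * cross a3 a4) *: a2 - (cross a1 a2 * cross a3 a4) *: a3.
set E := (X in 0 < X).
have -> : E = dotv v v +
    cross a1 a2 * cross a3 a4 * (cross a1 a4 * cross a2 a3) * dotv a3 a3.
  by rewrite /E /cross !dotv2 /v /cross !mxE; ring.
rewrite ltr_wpDl ?dotv_ge0// !mulr_gt0// dotv_gt0//.
by apply: contraTneq p34 => ->; rewrite /cross !mxE !mul0r subrr ltxx.
Qed.

(** The 3x3 determinant with rows [(a_i, b_i)], expanded along its last column. *)
Definition det_lines a1 a2 a3 (b1 b2 b3 : R) : R :=
  cross a2 a3 * b1 - cross a1 a3 * b2 + cross a1 a2 * b3.

Lemma voronoi_of_chain a1 a2 a3 a4 (b1 b2 b3 b4 : R) :
    0 < cross a1 a2 -> 0 < cross a1 a3 -> 0 < cross a1 a4 ->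
    0 < cross a2 a3 -> 0 < cross a2 a4 -> 0 < cross a3 a4 ->
    0 < det_lines a1 a2 a3 b1 b2 b3 -> 0 < det_lines a1 a2 a4 b1 b2 b4 ->
    0 < det_lines a1 a3 a4 b1 b3 b4 -> 0 < det_lines a2 a3 a4 b2 b3 b4 ->
  exists S T : {fset 'rV[R]_2},
    [/\ (S `<=` T)%fset, #|` S|%fset = 2, #|` T|%fset = 4 &
      voronoi_cell T S = [set x | [/\ dotv a1 x <= b1, dotv a2 x <= b2,
                                      dotv a3 x <= b3 & dotv a4 x <= b4]]].
Proof.
move=> p12 p13 p14 p23 p24 p34 l4_gt0 l3_gt0 l2_gt0 l1_gt0.
(* Cramer's rule: the l_i, with alternating signs, are the coefficients of the
   linear relation between the four vectors (a_i, b_i) of R^3. *)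
set l4 := (X in 0 < X) in l4_gt0; set l3 := (X in 0 < X) in l3_gt0.
set l2 := (X in 0 < X) in l2_gt0; set l1 := (X in 0 < X) in l1_gt0.
have crossZ k k' u v : cross (k *: u) (k' *: v) = k * k' * cross u v.
  by rewrite /cross !mxE; ring.
have rel_a : l1 *: a1 + l3 *: a3 = l2 *: a2 + l4 *: a4.
  by apply: row2P; rewrite !mxE /l1 /l2 /l3 /l4 /det_lines /cross; ring.
have rel_b : l1 * b1 + l3 * b3 = l2 * b2 + l4 * b4.
  by rewrite /l1 /l2 /l3 /l4 /det_lines /cross; ring.
have n12 : 0 < cross (l1 *: a1) (l2 *: a2) by rewrite crossZ !mulr_gt0.
have n14 : 0 < cross (l1 *: a1) (l4 *: a4) by rewrite crossZ !mulr_gt0.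
have scale_neq0 l a c : 0 < l -> 0 < cross a c \/ 0 < cross c a -> l *: a != 0.
  move=> l_gt0 ca; rewrite scaler_eq0 (gt_eqF l_gt0) /=; apply/eqP => a0.
  by case: ca; rewrite a0 /cross !mxE; lra.
have [n1 n2 n3 n4] : [/\ l1 *: a1 != 0, l2 *: a2 != 0, l3 *: a3 != 0 & l4 *: a4 != 0].
  split; [apply: (scale_neq0 _ _ a2)|apply: (scale_neq0 _ _ a1)
         |apply: (scale_neq0 _ _ a1)|apply: (scale_neq0 _ _ a1)] => //; tauto.
have [||p [nu [nu_gt0 eq1 eq2 eq3 eq4]]] :=
    reflections_solvable rel_a rel_b (lt0r_neq0 n12).
- by apply: sine_gt0; rewrite // crossZ !mulr_gt0.
(* Pulling out the scales [l1 * l2 * l4] leaves the determinant of constraints 1, 2 and 4, which is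
   [l3]. *)
- rewrite !crossZ (_ : _ + _ = l1 * l2 * l4 * l3) ?mulr_gt0//.
  by rewrite [in RHS]/l3 /det_lines; ring.
have cancel_l l a b x : 0 < l -> (dotv (l *: a) x <= l * b) = (dotv a x <= b).
  by move=> l_gt0; rewrite dotvZl ler_pM2l.
pose s1 := p - nu *: (l1 *: a1); pose s2 := p - nu *: (l2 *: a2).
pose t := s1 + nu *: (l4 *: a4).
have ps1 : p = s1 + nu *: (l1 *: a1) by rewrite subrK.
have ps2 : p = s2 + nu *: (l2 *: a2) by rewrite subrK.
have ts2 : t = s2 + nu *: (l3 *: a3).
  have -> : l3 *: a3 = l2 *: a2 + l4 *: a4 - l1 *: a1 by rewrite -rel_a addrC addKr.
  by rewrite scalerBr scalerDr /t /s1 /s2; apply: row2P; rewrite !mxE; ring.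
have nu_neq0 := lt0r_neq0 nu_gt0.
have shift_neq s w : w != 0 -> s != s + nu *: w.
  by move=> w_neq0; rewrite addrC -subr_eq subrr eq_sym scaler_eq0 negb_or nu_neq0.
have s12 : s1 != s2.
  rewrite (inj_eq (addrI p)) (inj_eq oppr_inj) (inj_eq (scalerI nu_neq0)).
  by apply: contraTneq n12 => ->; rewrite /cross; lra.
have pt : p != t.
  rewrite ps1 (inj_eq (addrI s1)) (inj_eq (scalerI nu_neq0)).
  by apply: contraTneq n14 => ->; rewrite /cross; lra.
have uniq_st : uniq [:: s1; s2; p; t].
  rewrite /= !inE !negb_or s12 pt.
  have -> : s1 != p by rewrite ps1 shift_neq.
  have -> : s2 != p by rewrite ps2 shift_neq.
  have -> : s2 != t by rewrite ts2 shift_neq.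
  by rewrite shift_neq.
exists [fset s1; s2]%fset, [fset s1; s2; p; t]%fset; split.
- by apply/fsubsetP => z; rewrite !inE => ->.
- by rewrite cardfs2 s12.
- move: uniq_st; rewrite /= !inE !negb_or => /and4P[/and3P[_ s1p s1t] /andP[s2p s2t] _ _].
  rewrite -fsetUA cardfsU !cardfs2 s12 pt.
  suff -> : ([fset s1; s2] `&` [fset p; t] = fset0)%fset by rewrite cardfs0.
  apply/fsetP => z; rewrite !inE; apply/negP => /andP[/orP[]/eqP-> /orP[]/eqP E].
  + by rewrite E eqxx in s1p.
  + by rewrite E eqxx in s1t.
  + by rewrite E eqxx in s2p.
  + by rewrite E eqxx in s2t.
rewrite (voronoi_cell_pairs uniq_st).
have h1 x : (enorm (x - s1) <= enorm (x - p)) = (dotv a1 x <= b1).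
  rewrite {1}ps1 (enorm_bisector _ nu_gt0 (c := l1 * b1)) ?cancel_l//.
  by rewrite -eq1 /s1 dotvDl dotvNl dotvZl; ring.
have h2 x : (enorm (x - s2) <= enorm (x - p)) = (dotv a2 x <= b2).
  rewrite {1}ps2 (enorm_bisector _ nu_gt0 (c := l2 * b2)) ?cancel_l//.
  by rewrite -eq2 /s2 dotvDl dotvNl dotvZl; ring.
have h3 x : (enorm (x - s2) <= enorm (x - t)) = (dotv a3 x <= b3).
  rewrite ts2 (enorm_bisector _ nu_gt0 (c := l3 * b3)) ?cancel_l//.
  by rewrite -eq3 /s2 dotvDl dotvNl dotvZl; ring.
have h4 x : (enorm (x - s1) <= enorm (x - t)) = (dotv a4 x <= b4).
  rewrite (enorm_bisector _ nu_gt0 (c := l4 * b4)) ?cancel_l//.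
  by rewrite -eq4 /s1 dotvDl dotvNl dotvZl; ring.
apply/seteqP; split => x [y1 y2 y3 y4].
- by split; [rewrite -h1|rewrite -h2|rewrite -h3|rewrite -h4].
- by split; [rewrite h1|rewrite h4|rewrite h2|rewrite h3].
Qed.

End Plane.

(** * Lines, segments and one-dimensional sets in the plane *)

Section PlaneLines.
Variable R : realType.
Implicit Types (u v w x a p : 'rV[R]_2).

Lemma dotv_segment a x y (t : R) :
  dotv a ((1 - t) *: x + t *: y) = (1 - t) * dotv a x + t * dotv a y.
Proof. by rewrite dotvDr !dotvZr. Qed.

Lemma dotv_perp u : dotv u (perp u) = 0.
Proof. by rewrite dotv2 !mxE /=; ring. Qed.

Lemma perp_neq0 u : u != 0 -> perp u != 0.
Proof.
apply: contraNneq => pu0; apply/eqP; apply: row2P; rewrite mxE.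
- by have := congr1 (fun v : 'rV_2 => v 0 1) pu0; rewrite !mxE.
- have := congr1 (fun v : 'rV_2 => v 0 0) pu0; rewrite !mxE /= => /eqP.
  by rewrite oppr_eq0 => /eqP.
Qed.

(** Eliminating between the two orthogonality relations shows that [cross u w] is killed by both
    coordinates of [a], so [w] has no component along [perp u]. *)
Lemma orthogonal_colinear a u w : a != 0 -> u != 0 ->
  dotv a u = 0 -> dotv a w = 0 -> exists t : R, w = t *: u.
Proof.
move=> a_neq0 u_neq0 au0 aw0; have uu_neq0 := lt0r_neq0 (dotv_gt0 u_neq0).
have uw0 : cross u w = 0.
  have a0 : a 0 0 * cross u w = 0.
    transitivity (dotv a u * w 0 1 - dotv a w * u 0 1); last by rewrite au0 aw0; ring.
    by rewrite !dotv2 /cross; ring.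
  have a1 : a 0 1 * cross u w = 0.
    transitivity (dotv a w * u 0 0 - dotv a u * w 0 0); last by rewrite au0 aw0; ring.
    by rewrite !dotv2 /cross; ring.
  apply: contra_neq_eq a_neq0 => uw_neq0; apply: row2P; rewrite mxE.
  + by apply: (mulIf uw_neq0); rewrite a0 mul0r.
  + by apply: (mulIf uw_neq0); rewrite a1 mul0r.
exists (dotv u w / dotv u u); apply: (scalerI uu_neq0).
rewrite scalerA mulrC divfK//.
have -> : dotv u u *: w = dotv u w *: u + cross u w *: perp u.
  by apply: row2P; rewrite !dotv2 /cross !mxE /=; ring.
by rewrite uw0 scale0r addr0.
Qed.

Lemma affine_line p u : affine_set (line p u).
Proof.
move=> x y t [s _ <-] [s' _ <-]; exists ((1 - t) * s + t * s') => //.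
by apply: row2P; rewrite !mxE; ring.
Qed.

(** Feeds the extremality of faces: if a segment from [w] can be prolonged beyond a point [z] of a
    face without leaving the polygon, then [w] is in the face. *)
Lemma open_segment_extend (e : R) w z : 0 < e ->
  open_segment w (z + e *: (z - w)) z.
Proof.
move=> e_gt0; have e1_gt0 : 0 < 1 + e by rewrite addr_gt0.
exists (1 + e)^-1 => /=.
  by rewrite in_itv /= invr_gt0 e1_gt0 invf_lt1 // ltrDl.
by apply: row2P; rewrite !mxE; field; rewrite lt0r_neq0.
Qed.

(** A set with at most one point is affine, hence its own hull, whereas a line contains the distinct
    points [p] and [p + u]. *)
Lemma one_dimensional_nontrivial (G : set 'rV[R]_2) : one_dimensional G ->
  exists x y, [/\ G x, G y & x != y].
Proof.
move=> [p [u [u_neq0 hullG]]]; apply: contrapT => G_le1.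
have G_eq x y : G x -> G y -> x = y.
  by move=> Gx Gy; apply/eqP/negPn/negP => xy; apply: G_le1; exists x, y.
have affG : affine_set G.
  move=> x y t Gx Gy; rewrite (G_eq y x)// -scalerDl subrK scale1r//.
have hullE : affine_hull G = G by exact: smallest_id.
have Gp : G p by rewrite -hullE hullG; exists 0 => //; rewrite scale0r addr0.
have Gpu : G (p + u) by rewrite -hullE hullG; exists 1 => //; rewrite scale1r.
have /(congr1 (+%R (- p))) := G_eq _ _ Gp Gpu.
by rewrite addNr addKr => u0; rewrite -u0 eqxx in u_neq0.
Qed.

End PlaneLines.

(** Each ratio [|d j| / c j] is a term of the sum [M], so [1 / (1 + M)] works for all indices at
    once. *)
Lemma small_step (R : realType) (I : finType) (P : pred I) (c d : I -> R) :
  (forall j, P j -> 0 < c j) ->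
  exists2 e : R, 0 < e & forall j, P j -> e * `|d j| < c j.
Proof.
move=> c_gt0; pose M := \sum_(j | P j) `|d j| / c j.
have term_ge0 j : P j -> 0 <= `|d j| / c j by move=> Pj; rewrite divr_ge0// ltW// c_gt0.
have M1_gt0 : 0 < 1 + M by rewrite ltr_pwDl// sumr_ge0.
exists (1 + M)^-1; first by rewrite invr_gt0.
move=> j Pj; rewrite mulrC ltr_pdivrMr// -ltr_pdivrMl ?c_gt0// mulrC.
rewrite ltr_pwDl// /M (bigD1 j)//= lerDl sumr_ge0// => i /andP[Pi _].
exact: term_ge0.
Qed.

Lemma average_tight (R : realType) (t x y c : R) : 0 < t -> t < 1 ->
  x <= c -> y <= c -> (1 - t) * x + t * y = c -> x = c /\ y = c.
Proof.
move=> t0 t1 xc yc avg; have t1' : 0 < 1 - t by lra.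
have ge0 : 0 <= t * (c - y) by rewrite mulr_ge0 ?subr_ge0// ltW.
have xcE : x = c by apply: le_anti; rewrite xc -(ler_pM2l t1'); lra.
split=> //; apply: (mulfI (lt0r_neq0 t0)); move: avg; rewrite xcE; lra.
Qed.

(** * Sides of a polygon given by irredundant constraints *)

Section Polygon.
Variables (R : realType) (I : finType) (a : I -> 'rV[R]_2) (b : I -> R).
Variable A : {set I}.

(** Keeping [A] as a subset of a fixed index type lets constraints be dropped without reindexing. *)
Definition polygon : set 'rV[R]_2 :=
  [set x | forall i, i \in A -> dotv (a i) x <= b i].

Definition edge i : set 'rV[R]_2 :=
  [set x | polygon x /\ dotv (a i) x = b i].

Lemma polygon_segment x y (t : R) : 0 <= t -> t <= 1 ->
  polygon x -> polygon y -> polygon ((1 - t) *: x + t *: y).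
Proof.
move=> t0 t1 Fx Fy i iA; rewrite dotv_segment.
have -> : b i = (1 - t) * b i + t * b i by ring.
by rewrite lerD// ler_wpM2l ?subr_ge0//; [apply: Fx|apply: Fy].
Qed.

Lemma polygon_move z u :
  polygon z -> (forall i, i \in A -> dotv (a i) z < b i \/ dotv (a i) u = 0) ->
  exists2 e : R, 0 < e & polygon (z + e *: u).
Proof.
move=> Fz strict.
have [|e e_gt0 He] := @small_step R I [pred i in A | dotv (a i) z < b i]
  (fun i => b i - dotv (a i) z) (fun i => dotv (a i) u).
  by move=> j /= /andP[_]; rewrite subr_gt0.
exists e => // i iA; rewrite dotvDr dotvZr.
have [lt_i|->] := strict i iA; last by rewrite mulr0 addr0 Fz.
have := He i; rewrite /= iA lt_i => /(_ isT) /ltW.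
have := ler_norm (dotv (a i) u); rewrite -(ler_pM2l e_gt0); lra.
Qed.

Hypothesis a_neq0 : forall i, i \in A -> a i != 0.

(** From [z] one can move a little in every direction, so each segment from a point of the polygon
    to [z] can be prolonged inside it. *)
Lemma face_of_strict G z : face polygon G -> G z ->
  (forall i, i \in A -> dotv (a i) z < b i) -> polygon `<=` G.
Proof.
move=> [GF _ Gext] Gz strict w Fw.
have [i iA|e e_gt0 Fe] := @polygon_move z (z - w) (GF _ Gz).
  by left; apply: strict.
by have [] := Gext _ _ _ Fw Fe Gz (open_segment_extend _ _ e_gt0).
Qed.

(** Otherwise the side would be the whole polygon, which contains a small step from [z]
    perpendicular to the line spanned by the side. *)
Lemma side_tight G z : sides polygon G -> G z ->
  exists2 i, i \in A & dotv (a i) z = b i.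
Proof.
move=> [faceG [p [u [u_neq0 hullG]]]] Gz; apply: contrapT => no_tight.
have [GF _ _] := faceG.
have strict i : i \in A -> dotv (a i) z < b i.
  move=> iA; rewrite lt_neqAle GF// andbT; apply/eqP => eq_i.
  by apply: no_tight; exists i.
have FG := face_of_strict faceG Gz strict.
have [i iA|e e_gt0 Fe] := @polygon_move z (perp u) (GF _ Gz).
  by left; apply: strict.
have inline x : G x -> line p u x by rewrite -hullG; apply: sub_gen_smallest.
have [t _ zE] := inline z Gz; have [t' _ zeE] := inline _ (FG _ Fe).
have pu_gt0 := dotv_gt0 (perp_neq0 u_neq0).
have := congr1 (dotv (perp u)) zeE; rewrite -zE !dotvDr !dotvZr.
rewrite (dotvC _ u) dotv_perp; have := mulr_gt0 e_gt0 pu_gt0; lra.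
Qed.

(** Irredundancy is used through a point [z i] in the relative interior of each edge, where only
    constraint [i] is tight. *)
Variable z : I -> 'rV[R]_2.
Hypothesis z_tight : forall i, i \in A -> dotv (a i) (z i) = b i.
Hypothesis z_strict :
  forall i j, i \in A -> j \in A -> j != i -> dotv (a j) (z i) < b j.

Lemma edge_witness i : i \in A -> edge i (z i).
Proof.
move=> iA; split; last exact: z_tight.
by move=> j jA; have [->|ji] := eqVneq j i; rewrite ?z_tight// ltW// z_strict.
Qed.

Lemma edge_inj : {in A &, injective edge}.
Proof.
move=> i j iA jA eq_ij; apply/eqP/negPn/negP => ij.
have := edge_witness iA; rewrite eq_ij => -[_ eq_j].
by have := z_strict iA jA; rewrite eq_sym eq_j ltxx => /(_ ij).
Qed.

(** The edge lies on the line, and it contains [z i] together with a second point [z i + e *: u],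
    which generate the line. *)
Lemma affine_hull_edge i u : i \in A -> u != 0 -> dotv (a i) u = 0 ->
  affine_hull (edge i) = line (z i) u.
Proof.
move=> iA u_neq0 au0; apply/seteqP; split.
  apply: smallest_sub; first exact: affine_line.
  move=> x [_ xi].
  have [|t tE] := @orthogonal_colinear _ (a i) u (x - z i) (a_neq0 iA) u_neq0 au0.
    by rewrite dotvDr dotvNr xi z_tight// subrr.
  by exists t => //; rewrite -tE addrC subrK.
move=> _ [t _ <-] B [affB EB].
have Ez := edge_witness iA.
have [j jA|e e_gt0 Fe] := @polygon_move (z i) u Ez.1.
  by have [->|ji] := eqVneq j i; [right|left; exact: z_strict].
have Ee : edge i (z i + e *: u).
  by split => //; rewrite dotvDr dotvZr au0 mulr0 addr0 z_tight.
have := affB _ _ (t / e) (EB _ Ez) (EB _ Ee); congr B.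
by apply: row2P; rewrite !mxE; field; rewrite lt0r_neq0.
Qed.

Lemma edge_side i : i \in A -> sides polygon (edge i).
Proof.
move=> iA; split; last first.
  exists (z i), (perp (a i)); split; first by rewrite perp_neq0 ?a_neq0.
  by apply: affine_hull_edge; rewrite ?perp_neq0 ?a_neq0 ?dotv_perp.
split=> [x []//|x y k|x y w Fx Fy [_ wi] [t]].
- rewrite !inE => -[Fx xi] [Fy yi].
  (* [conv k] puts the weight [k] on the first point, hence the parameter [1 - k]. *)
  have -> : conv k x y = (1 - (1 - k%:num)) *: x + (1 - k%:num) *: y :> 'rV[R]_2.
    by rewrite subKr.
  have k0 : 0 <= k%:num :> R by [].
  have k1 : k%:num <= 1 :> R by [].
  split; first by apply: polygon_segment => //; lra.
  by rewrite dotv_segment xi yi; ring.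
- rewrite /= in_itv /= => /andP[t0 t1] wE.
  have xi := Fx i iA; have yi := Fy i iA.
  move: wi; rewrite -wE dotv_segment => /(average_tight t0 t1 xi yi)[].
  by split; split.
Qed.

(** A constraint tight at the midpoint [m] of two points of [G] is tight at both, hence along the
    whole line spanned by [G]. Conversely, from a point [w] of that edge the segment to [m] can be
    prolonged within [G], so extremality gives [w] in [G]. *)
Lemma side_edge G : sides polygon G -> exists2 i, i \in A & G = edge i.
Proof.
move=> sideG; have [[GF convG Gext] dimG] := sideG.
have [x [y [Gx Gy xy]]] := one_dimensional_nontrivial dimG.
have Gseg (k : R) : 0 <= k -> k <= 1 -> G ((1 - k) *: x + k *: y).
  move=> k0 k1; have k0' : 0 <= 1 - k by lra.
  have k1' : 1 - k <= 1 by lra.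
  have -> : (1 - k) *: x + k *: y = conv (Itv01 k0' k1') (x : convex_lmodType _) y.
    by rewrite -[in k *: y](subKr 1 k).
  by have := convG x y (Itv01 k0' k1'); rewrite !inE => /(_ Gx Gy).
pose m := (1 - 2^-1) *: x + 2^-1 *: y.
have Gm : G m by apply: Gseg; lra.
have [i iA mi] := side_tight sideG Gm; exists i => //.
have [xi yi] : dotv (a i) x = b i /\ dotv (a i) y = b i.
  move: mi (GF _ Gx i iA) (GF _ Gy i iA); rewrite dotv_segment; split; lra.
have [p [u [u_neq0 hullG]]] := dimG.
have inline w : G w -> line p u w by rewrite -hullG; apply: sub_gen_smallest.
have aiu0 : dotv (a i) u = 0.
  have [s _ sE] := inline _ Gx; have [s' _ s'E] := inline _ Gy.
  move: xi yi; rewrite -sE -s'E !dotvDr !dotvZr => xi yi.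
  have ss' : s - s' != 0.
    by rewrite subr_eq0; apply: contraNneq xy => ss'; rewrite -sE -s'E ss'.
  by apply: (mulfI ss'); rewrite mulr0; lra.
apply/seteqP; split => w.
  move=> Gw; split; first exact: GF.
  have [s _ sE] := inline _ Gx; have [t _ <-] := inline _ Gw.
  by rewrite -xi -sE !dotvDr !dotvZr aiu0; lra.
move=> [Fw wi]; have [|||t tE] := @orthogonal_colinear _ (a i) (y - x) (w - m) (a_neq0 iA).
- by rewrite subr_eq0 eq_sym.
- by rewrite dotvDr dotvNr xi yi subrr.
- by rewrite dotvDr dotvNr wi mi subrr.
(* Chosen so that [e * t] is at most 1/2 in absolute value: the prolongation then stays between [x]
   and [y]. *)
pose e := (2 * (`|t| + 1))^-1.
have t1_gt0 : 0 < `|t| + 1 by rewrite ltr_wpDl.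
have e_gt0 : 0 < e by rewrite invr_gt0 mulr_gt0.
have /andP[et1 et2] : - 2^-1 <= e * t <= 2^-1.
  rewrite -ler_norml normrM gtr0_norm// /e invfM -mulrA ler_piMr//.
  by rewrite mulrC ler_pdivrMr// mul1r lerDl.
have Gw' : G (m + e *: (m - w)).
  have -> : m + e *: (m - w) = (1 - (2^-1 - e * t)) *: x + (2^-1 - e * t) *: y.
    have -> : m - w = - (t *: (y - x)) by rewrite -tE opprB.
    by rewrite /m; apply: row2P; rewrite !mxE; lra.
  by apply: Gseg; lra.
by have [] := Gext _ _ _ Fw (GF _ Gw') Gm (open_segment_extend _ _ e_gt0).
Qed.

End Polygon.

(** * Irredundant subsystems and their witnesses *)

Section MinimalPolygon.
Variables (R : realType) (I : finType) (a : I -> 'rV[R]_2) (b : I -> R).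
Implicit Types A : {set I}.

(** Take an inclusion-minimal index set defining the polygon; a constraint that no point violates
    alone could be removed from it. *)
Lemma minimal_polygon : exists A : {set I}, polygon a b A = polygon a b [set: I]%SET /\
  forall i, i \in A -> exists y, b i < dotv (a i) y /\
    forall j, j \in A -> j != i -> dotv (a j) y <= b j.
Proof.
pose P (B : {set I}) := `[< polygon a b B = polygon a b [set: I]%SET >].
have exP : exists B, P B by exists [set: I]%SET; apply/asboolP.
have [A /minsetP[/asboolP PA minA]] := ex_minset exP.
exists A; split => // i iA; apply: contrapT => redundant.
have PAi : P (A :\ i).
  apply/asboolP; rewrite -PA; apply/seteqP; split => x Fx j; last first.
    by rewrite finset.in_setD1 => /andP[_]; apply: Fx.
  move=> jA; have [->|ji] := eqVneq j i; last by apply: Fx; rewrite finset.in_setD1 ji.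
  rewrite leNgt; apply/negP => xi; apply: redundant; exists x; split => // k kA ki.
  by apply: Fx; rewrite finset.in_setD1 ki.
have := finset.setD11 i A; rewrite (minA _ PAi) ?iA//; exact: subD1set.
Qed.

(** A small move along [a i] stays in the polygon and increases [dotv (a i)]. *)
Lemma interior_strict A x : (polygon a b A)° x ->
  forall i, i \in A -> a i != 0 -> dotv (a i) x < b i.
Proof.
move=> intx i iA ai_neq0.
have cvg_x : (fun t : R => x + t *: a i) @ 0^'+ --> x + 0 *: a i.
  apply: cvgD; first exact: cvg_cst.
  by apply: cvgZr_tmp; apply: cvg_at_right_filter; exact: cvg_id.
rewrite scale0r addr0 in cvg_x.
have near_x : \forall t \near 0^'+, polygon a b A (x + t *: a i) by exact: (cvg_x _ intx).
have [t [t_gt0 Ft]] : exists t : R, 0 < t /\ polygon a b A (x + t *: a i).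
  near (0 : R)^'+ => t; exists t; split; last by near: t.
  by near: t; exact: nbhs_right_gt.
have := Ft i iA; rewrite dotvDr dotvZr.
have := mulr_gt0 t_gt0 (dotv_gt0 ai_neq0); lra.
Unshelve. all: by end_near. Qed.

(** The segment from the interior point [x] to the violating point [y] crosses line [i] before
    reaching [y], so the other constraints are still strict there. *)
Lemma facet_witness A x i y : i \in A ->
    (forall j, j \in A -> dotv (a j) x < b j) ->
    b i < dotv (a i) y -> (forall j, j \in A -> j != i -> dotv (a j) y <= b j) ->
  exists z, dotv (a i) z = b i /\ forall j, j \in A -> j != i -> dotv (a j) z < b j.
Proof.
move=> iA x_in yi y_in; have xi := x_in i iA.
have D_gt0 : 0 < dotv (a i) y - dotv (a i) x by lra.
pose t := (b i - dotv (a i) x) / (dotv (a i) y - dotv (a i) x).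
have t_lt1 : 0 < 1 - t by rewrite subr_gt0 ltr_pdivrMr// mul1r; lra.
have t_gt0 : 0 < t by rewrite divr_gt0// subr_gt0.
exists ((1 - t) *: x + t *: y); split=> [|j jA ji]; rewrite dotv_segment.
  have tE : t * (dotv (a i) y - dotv (a i) x) = b i - dotv (a i) x.
    by rewrite divfK// gt_eqF.
  lra.
have := x_in j jA; rewrite -(ltr_pM2l t_lt1).
have := y_in j jA ji; rewrite -(ler_pM2l t_gt0); lra.
Qed.

End MinimalPolygon.

Lemma card_eq_finset (I : finType) (A : {set I}) : [set` A] #= `I_#|A|.
Proof.
have -> : [set` A] = [set` [fset x in enum A]%fset].
  by apply/seteqP; split => x /=; rewrite !inE mem_enum.
by apply/card_eq_fsetP; rewrite card_fseq undup_id ?enum_uniq// -cardE.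
Qed.

(** * Ordering of the normals and recession directions *)

Section Cross.
Variable R : realType.
Implicit Types (a d u x : 'rV[R]_2).

Lemma dotv_ray_le0 a p u (c : R) :
  (forall x, ray p u x -> dotv a x <= c) -> dotv a u <= 0.
Proof.
move=> Hray; rewrite leNgt; apply/negP => au_gt0.
(* At this parameter [dotv a] exceeds [c] by at least [dotv a u]; the absolute value keeps [t]
   nonnegative. *)
pose t := `|c - dotv a p| / dotv a u + 1.
have t_ge0 : 0 <= t by rewrite addr_ge0// divr_ge0// ltW.
have : dotv a (p + t *: u) <= c by apply: Hray; exists t; rewrite //= in_itv /= t_ge0.
rewrite dotvDr dotvZr /t mulrDl divfK ?gt_eqF// mul1r.
by have := ler_norm (c - dotv a p); lra.
Qed.

(** On the open halfplane of vectors with negative product with [d], this quotient increases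
    counterclockwise. *)
Lemma cross_slope d a a' : d != 0 -> dotv a d < 0 -> dotv a' d < 0 ->
    cross d a / dotv a d <= cross d a' / dotv a' d ->
  0 <= cross a a'.
Proof.
move=> d_neq0 ad a'd; rewrite -(ler_nM2r ad) divfK ?lt_eqF// mulrAC.
rewrite ler_ndivrMr// => h.
rewrite -(pmulr_rge0 _ (dotv_gt0 d_neq0)).
have -> : dotv d d * cross a a' =
    cross d a' * dotv a d - cross d a * dotv a' d.
  by rewrite /cross !dotv2; ring.
by rewrite subr_ge0.
Qed.

(* The middle normal is a positive combination of the outer two, so a point
   violating only the middle constraint forces the strict inequality. *)
Lemma det_lines_gt0 a1 a2 a3 (b1 b2 b3 : R) y :
    0 < cross a1 a2 -> 0 < cross a1 a3 -> 0 < cross a2 a3 ->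
    dotv a1 y <= b1 -> b2 < dotv a2 y -> dotv a3 y <= b3 ->
  0 < det_lines a1 a2 a3 b1 b2 b3.
Proof.
move=> p12 p13 p23 y1 y2 y3.
have -> : det_lines a1 a2 a3 b1 b2 b3 =
    cross a2 a3 * (b1 - dotv a1 y) + cross a1 a3 * (dotv a2 y - b2)
    + cross a1 a2 * (b3 - dotv a3 y).
  by rewrite /det_lines /cross !dotv2; ring.
have t1 := mulr_ge0 (ltW p23) (etrans (subr_ge0 _ _) y1).
have t2 := mulr_gt0 p13 (etrans (subr_gt0 _ _) y2).
have t3 := mulr_ge0 (ltW p12) (etrans (subr_ge0 _ _) y3).
by rewrite ltr_wpDr// ltr_wpDl.
Qed.

End Cross.

(** Tilting [u] slightly towards [- a k] makes constraint [k] strict and keeps the others strict. *)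
Lemma strict_recession (R : realType) (I : finType) (a : I -> 'rV[R]_2)
    (A : {set I}) (k : I) (u : 'rV[R]_2) : a k != 0 -> dotv (a k) u = 0 ->
    (forall j, j \in A -> j != k -> dotv (a j) u < 0) ->
  exists d, forall j, j \in A -> dotv (a j) d < 0.
Proof.
move=> ak_neq0 aku neg.
have [|e e_gt0 He] := @small_step R I [pred j in A | j != k]
  (fun j => - dotv (a j) u) (fun j => dotv (a j) (a k)).
  by move=> j /andP[jA jk]; rewrite oppr_gt0 neg.
exists (u - e *: a k) => j jA; rewrite dotvDr dotvNr dotvZr.
have [->|jk] := eqVneq j k.
  by rewrite aku sub0r oppr_lt0 mulr_gt0 ?dotv_gt0.
have := He j; rewrite /= jA jk => /(_ isT).
by have := lerNnormlW (lexx `|dotv (a j) (a k)|); rewrite -(ler_pM2l e_gt0); lra.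
Qed.

(** * From the quadrilateral to four ordered constraints *)

Lemma quadrilateral_normals (R : realType) (F : set 'rV[R]_2) :
    unbounded_convex_quadrilateral F -> no_sides_parallel F ->
  exists (I : finType) (a : I -> 'rV[R]_2) (b : I -> R) (A : {set I}),
    [/\ F = polygon a b A, #|A| = 4,
      forall i, i \in A -> exists y, b i < dotv (a i) y /\
        forall j, j \in A -> j != i -> dotv (a j) y <= b j,
      forall i j, i \in A -> j \in A -> i != j -> cross (a i) (a j) != 0 &
      exists d, forall i, i \in A -> dotv (a i) d < 0].
Proof.
move=> [[[m [H [halfH FH]]] _ [x0 intF]] card_sides _ _ rays] no_par.
have /choice[ab abP] : forall i, exists c : 'rV[R]_2 * R,
    c.1 != 0 /\ H i = [set x | dotv c.1 x <= c.2].
  by move=> i; have [a [b ?]] := halfH i; exists (a, b).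
pose a i := (ab i).1; pose b i := (ab i).2.
have a_neq0 i : a i != 0 by have [] := abP i.
have [A [FA irred]] := minimal_polygon a b.
have {}FA : F = polygon a b A.
  rewrite FA FH; apply/seteqP; split => x.
    by move=> Fx i _; have := Fx i I; have [_ ->] := abP i.
  by move=> Fx i _; have [_ ->] := abP i; apply: Fx; rewrite inE.
rewrite FA in intF card_sides rays no_par.
have x0_strict j : j \in A -> dotv (a j) x0 < b j.
  by move=> jA; apply: interior_strict intF _ jA (a_neq0 j).
have /choice[z zP] : forall i, exists z, i \in A -> dotv (a i) z = b i /\
    forall j, j \in A -> j != i -> dotv (a j) z < b j.
  move=> i; have [iA|] := boolP (i \in A); last by exists 0.
  have [y [yi y_in]] := irred i iA.
  by have [z ?] := facet_witness iA x0_strict yi y_in; exists z.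
have z_tight i : i \in A -> dotv (a i) (z i) = b i by move=> /zP[].
have z_strict i j : i \in A -> j \in A -> j != i -> dotv (a j) (z i) < b j.
  by move=> /zP[_]; apply.
have a_neq0' i : i \in A -> a i != 0 by [].
have sidesE : sides (polygon a b A) = edge a b A @` [set` A].
  apply/seteqP; split => [G /(side_edge a_neq0')[i iA ->]|_ [i iA <-]].
    by exists i.
  exact: edge_side z_tight z_strict _ iA.
(* If the cross product vanished, both edges would span lines of direction [perp (a i)] and be
   parallel sides. *)
have cross_neq0 i j : i \in A -> j \in A -> i != j -> cross (a i) (a j) != 0.
  move=> iA jA ij; apply/eqP => cross0.
  have sI := edge_side a_neq0' z_tight z_strict iA.
  have sJ := edge_side a_neq0' z_tight z_strict jA.
  apply: (no_par _ _ sI sJ).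
    by move/(edge_inj z_tight z_strict iA jA); apply/eqP.
  exists (z i), (z j), (perp (a i)); split; first exact: perp_neq0.
    by apply: affine_hull_edge; rewrite ?perp_neq0 ?dotv_perp.
  apply: affine_hull_edge; rewrite ?perp_neq0//.
  by rewrite dotv2 !mxE /= -[RHS]cross0 /cross; ring.
exists _, a, b, A; split => //.
  apply/eqP; rewrite eq_sym; apply/eqP/card_eq_II.
  apply: card_eq_trans (card_eq_finset A).
  rewrite card_eq_sym; apply: card_eq_trans card_sides.
  rewrite card_eq_sym sidesE; apply: inj_card_eq.
  by move=> i j; rewrite !inE; exact: (edge_inj z_tight z_strict).
(* The direction [u] of one unbounded side is a recession direction orthogonal to the normal of that
   side. *)
have [G [sideG [_ [p [u [u_neq0 GE]]]]]] : [set G | sides (polygon a b A) G /\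
    ~ bounded_set G /\ is_ray G] !=set0.
  apply/set0P/eqP => rays0; move: rays; rewrite rays0 card_eq_sym card_eq0.
  by move=> /eqP/seteqP[/(_ 0%N isT)].
have [k kA Gk] := side_edge a_neq0' sideG.
have ray_edge x : ray p u x -> edge a b A k x by rewrite -GE Gk.
have u_le0 j : j \in A -> dotv (a j) u <= 0.
  by move=> jA; apply: (@dotv_ray_le0 _ _ p _ (b j)) => x /ray_edge[/(_ j jA)].
have aku : dotv (a k) u = 0.
  have pk : edge a b A k p.
    by apply: ray_edge; exists 0; rewrite ?scale0r ?addr0//= in_itv /= lexx.
  have puk : edge a b A k (p + u).
    by apply: ray_edge; exists 1; rewrite ?scale1r//= in_itv /= ler01.
  by move: puk.2; rewrite dotvDr pk.2; lra.
apply: (strict_recession (a_neq0 k) aku) => j jA jk.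
(* Equality would make [a j] and [a k] both orthogonal to [u], hence parallel. *)
rewrite lt_neqAle u_le0// andbT; apply/eqP => aju.
have [t tE] := orthogonal_colinear (a_neq0 j) u_neq0 aju (dotv_perp (a j)).
have t_neq0 : t != 0.
  apply: contraTneq (perp_neq0 (a_neq0 j)) => t0.
  by rewrite tE t0 scale0r eqxx.
have /eqP := cross_neq0 _ _ jA kA (jk); apply.
transitivity (dotv (a k) (perp (a j))).
  by rewrite dotv2 !mxE /= /cross; ring.
by rewrite tE dotvZr aku mulr0.
Qed.

Theorem proposition3p12 (R : realType) (F : set 'rV[R]_2)
    (hF : unbounded_convex_quadrilateral F) (hpar : no_sides_parallel F) :
  exists S T : {fset 'rV[R]_2},
    (S `<=` T)%fset /\ #|` S|%fset = 2 /\ #|` T|%fset = 4 /\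
    voronoi_cell T S = F.
Proof.
have [I [a [b [A [FA card_A irred cross_neq0 [d d_lt0]]]]]] :=
  quadrilateral_normals hF hpar.
(* Sorting by this slope lists the normals counterclockwise, which makes all cross products of
   ordered pairs positive. *)
pose slope i := cross d (a i) / dotv (a i) d.
pose r : rel I := fun i j => slope i <= slope j.
have r_trans : transitive r by move=> j i k; exact: le_trans.
have r_total : total r by move=> i j; exact: le_total.
have := sort_sorted r_total (enum A); rewrite sorted_pairwise//.
have := sort_uniq r (enum A); rewrite enum_uniq.
have := size_sort r (enum A); rewrite -cardE card_A.
have : sort r (enum A) =i A by move=> i; rewrite mem_sort mem_enum.
case: (sort r (enum A)) => [//|i1 [//|i2 [//|i3 [//|i4 [|//]]]]] memA _.
rewrite /= !inE !negb_or !andbT => /and3P[/and3P[n12 n13 n14] /andP[n23 n24] n34].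
move=> /and3P[/and3P[r12 r13 r14] /andP[r23 r24] r34].
have [A1 A2 A3 A4] : [/\ i1 \in A, i2 \in A, i3 \in A & i4 \in A].
  by rewrite -!memA !inE !eqxx !orbT.
have d_neq0 : d != 0.
  by apply: contraTneq (d_lt0 _ A1) => ->; rewrite dotv2 !mxE !mulr0 addr0 ltxx.
have pos i j : i \in A -> j \in A -> i != j -> r i j -> 0 < cross (a i) (a j).
  move=> iA jA ij rij; rewrite lt_neqAle eq_sym cross_neq0//=.
  exact: (cross_slope d_neq0 (d_lt0 _ iA) (d_lt0 _ jA) rij).
have det_pos i j k : i \in A -> j \in A -> k \in A -> i != j -> i != k -> j != k ->
    r i j -> r i k -> r j k ->
  0 < det_lines (a i) (a j) (a k) (b i) (b j) (b k).
  (* The witness violates only the middle constraint [j]. *)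
  move=> iA jA kA ij ik jk rij rik rjk; have [y [yj y_in]] := irred j jA.
  by apply: (det_lines_gt0 (y := y)); rewrite ?pos ?y_in// eq_sym.
have [S [T [ST cardS cardT cellE]]] := voronoi_of_chain
  (pos _ _ A1 A2 n12 r12) (pos _ _ A1 A3 n13 r13) (pos _ _ A1 A4 n14 r14)
  (pos _ _ A2 A3 n23 r23) (pos _ _ A2 A4 n24 r24) (pos _ _ A3 A4 n34 r34)
  (det_pos _ _ _ A1 A2 A3 n12 n13 n23 r12 r13 r23)
  (det_pos _ _ _ A1 A2 A4 n12 n14 n24 r12 r14 r24)
  (det_pos _ _ _ A1 A3 A4 n13 n14 n34 r13 r14 r34)
  (det_pos _ _ _ A2 A3 A4 n23 n24 n34 r23 r24 r34).
exists S, T; do 3!split => //; rewrite cellE FA.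
apply/seteqP; split => x; last by move=> Fx; split; apply: Fx.
by case=> x1 x2 x3 x4 i; rewrite -memA !inE => /or4P[] /eqP->.
Qed.
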